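(* There is a constant $c$ such that for all natural numbers $\alpha,n$ and every $x\in\{0,1\}^n$ there is $y\in\{0,1\}^n$ such that $CC^{\alpha}_I(x,y)\ge n-\alpha$ and $C(y\mid x)\le\alpha+c$.
   Context: $C(\cdot\mid\cdot)$ denotes plain conditional Kolmogorov complexity with respect to a fixed universal Turing machine. A protocol for strings of length $n$ is a deterministic two-party communication protocol: Alice holds $x\in\{0,1\}^n$, Bob holds $y\in\{0,1\}^n$, they exchange bits and Alice outputs a value; its complexity is $C(P\mid n)$. A total protocol terminates on all inputs. $I(x,y)=y$. A total protocol $P$ is said to compute $I$ on $(x,y)$ if Alice outputs $y$ on input $(x,y)$ (it may output wrong values on other inputs); in that case $CC^P(x,y)$ is the number of bits exchanged on $(x,y)$, otherwise $CC^P(x,y)=\infty$. $CC^\alpha_I(x,y)$ is the minimum of $CC^P(x,y)$ over all total protocols $P$ of complexity at most $\alpha$ (minimum of the empty set is $\infty$). *)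

(* Defs.v *)
From mathcomp Require Import all_boot.
From mathcomp Require Import boolp.

Set Implicit Arguments.
Unset Strict Implicit.
Unset Printing Implicit Defensive.

(* [option nat] stands for the extended natural numbers: [None] is infinity. *)

Definition ele (a b : option nat) : bool :=
  match a, b with
  | _, None => true
  | None, Some _ => false
  | Some m, Some k => m <= k
  end.

Definition emin (A : option nat -> Prop) : option nat :=
  if pselect (exists m, `[< A (Some m) >]) is left h
  then Some (ex_minn h) else None.

(* Deterministic multi-tape Turing machines over {blank, 0, 1}; [None] is the
   blank.  There are [extra_tapes.+2] two-way infinite tapes; the machine halts
   when [delta] returns [None]. *)

Definition symbol := option bool.

Inductive move := MoveL | Stay | MoveR.

Record machine := Machine {
  state : finType;
  start : state;
  extra_tapes : nat;
  delta : state -> {ffun 'I_extra_tapes.+2 -> symbol} ->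
          option (state * {ffun 'I_extra_tapes.+2 -> symbol * move})
}.

(* [(l, r)] is the tape whose cells from the head rightwards are [r] and whose
   cells to the left of the head, nearest first, are [l]; all cells beyond the
   two lists are blank. *)
Definition tape := (seq symbol * seq symbol)%type.

Definition scan (t : tape) : symbol := head None t.2.

Definition write_move (t : tape) (a : symbol * move) : tape :=
  let l := t.1 in
  let r := a.1 :: behead t.2 in
  match a.2 with
  | MoveL => (behead l, head None l :: r)
  | Stay => (l, r)
  | MoveR => (a.1 :: l, behead r)
  end.

Definition tape_of (s : seq bool) : tape := ([::], map Some s).

Fixpoint read_bits (r : seq symbol) : seq bool :=
  if r is Some b :: r' then b :: read_bits r' else [::].

Section Run.
Variable M : machine.

Definition config :=
  (state M * {ffun 'I_(extra_tapes M).+2 -> tape})%type.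

Definition step (c : config) : option config :=
  omap (fun a : state M * {ffun 'I_(extra_tapes M).+2 -> symbol * move} =>
          (a.1, [ffun i => write_move (c.2 i) (a.2 i)]))
       (delta c.1 [ffun i => scan (c.2 i)]).

(* Program on tape 0, condition on tape 1, all other tapes blank. *)
Definition init (p z : seq bool) : config :=
  (start M,
   [ffun i : 'I_(extra_tapes M).+2 =>
      match val i with
      | 0 => tape_of p
      | 1 => tape_of z
      | _ => tape_of [::]
      end]).

(* The output is written on tape 0, from the head up to the first blank. *)
Definition output (c : config) : seq bool := read_bits (c.2 ord0).2.

(* On program [p] and condition [z], [M] halts with output [w]. *)
Definition computes (p z w : seq bool) : Prop :=
  exists (t : nat) (c : config),
    [/\ iter t (obind step) (Some (init p z)) = Some c,
        step c = None & output c = w].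

End Run.

(* Universality in the sense of the invariance theorem: every machine is
   simulated with a constant overhead in program length.  A machine that runs
   [V] on [p] when given a fixed prefix for [V] followed by [p] is an
   instance. *)
Definition universal (U : machine) : Prop :=
  forall V : machine, exists c : nat, forall p z w : seq bool,
    computes V p z w ->
    exists2 q : seq bool, size q <= size p + c & computes U q z w.

(* The plain complexity C(w | z). *)
Definition C (U : machine) (w z : seq bool) : option nat :=
  emin (fun m => exists2 p : seq bool, computes U p z w & m = Some (size p)).

(* Little-endian binary numerals: the bit string given as the condition when
   the condition is a natural number. *)
Fixpoint bin_succ (s : seq bool) : seq bool :=
  match s with
  | [::] => [:: true]
  | false :: s' => true :: s'
  | true :: s' => false :: bin_succ s'
  end.

Definition bin_nat (n : nat) : seq bool := iter n bin_succ [::].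

(* Protocols for inputs of length [n]: finite trees whose internal nodes
   determine the next bit from the input of the party whose turn it is, and
   whose leaves determine the value output by Alice from her input.  A label
   [None] means that the party never sends a bit (resp. never outputs a value),
   so that the protocol does not terminate.  As there are finitely many inputs,
   the terminating runs of any protocol form such a finite tree. *)
Inductive protocol (n : nat) :=
| AliceOutputs of {ffun n.-tuple bool -> option (seq bool)}
| AliceSends of {ffun n.-tuple bool -> option bool} & protocol n & protocol n
| BobSends of {ffun n.-tuple bool -> option bool} & protocol n & protocol n.

Section Protocol.
Variable n : nat.

(* Number of bits exchanged and value output by Alice; after bit 0 (resp. 1)
   the run continues in the first (resp. second) subtree. *)
Fixpoint exec (P : protocol n) (x y : n.-tuple bool) :
    option (nat * seq bool) :=
  let after (b : option bool) (P0 P1 : option (nat * seq bool)) :=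
    obind (fun b : bool =>
      omap (fun r => (r.1.+1, r.2)) (if b then P1 else P0)) b in
  match P with
  | AliceOutputs f => omap (pair 0) (f x)
  | AliceSends f P0 P1 => after (f x) (exec P0 x y) (exec P1 x y)
  | BobSends f P0 P1 => after (f y) (exec P0 x y) (exec P1 x y)
  end.

Definition total (P : protocol n) : Prop :=
  forall x y : n.-tuple bool, isSome (exec P x y).

Definition CCP (f : n.-tuple bool -> n.-tuple bool -> seq bool)
    (P : protocol n) (x y : n.-tuple bool) : option nat :=
  if exec P x y is Some (m, v) then
    if v == f x y then Some m else None
  else None.

End Protocol.

(* All n-bit inputs, in lexicographic order. *)
Fixpoint inputs (n : nat) : seq (n.-tuple bool) :=
  match n return seq (n.-tuple bool) with
  | 0 => [:: [tuple]]
  | m.+1 => [seq cons_tuple b w | b <- [:: false; true], w <- inputs m]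
  end.

Definition code_bit (a : option bool) : seq bool :=
  if a is Some b then [:: true; b] else [:: false].

Definition code_string (a : option (seq bool)) : seq bool :=
  if a is Some s then true :: flatten [seq [:: true; b] | b <- s] ++ [:: false]
  else [:: false].

(* Injective for each [n] (see [encode_inj]): preorder traversal, each label
   being written out as a table of self-delimiting codes. *)
Fixpoint encode (n : nat) (P : protocol n) : seq bool :=
  match P with
  | AliceOutputs f =>
      false :: flatten [seq code_string (f x) | x <- inputs n]
  | AliceSends f P0 P1 =>
      [:: true, false & flatten [seq code_bit (f x) | x <- inputs n]]
        ++ encode P0 ++ encode P1
  | BobSends f P0 P1 =>
      [:: true, true & flatten [seq code_bit (f y) | y <- inputs n]]
        ++ encode P0 ++ encode P1
  end.

Definition protocol_C (U : machine) (n : nat) (P : protocol n) : option nat :=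
  C U (encode P) (bin_nat n).

Definition CC (U : machine) (n : nat)
    (f : n.-tuple bool -> n.-tuple bool -> seq bool)
    (alpha : nat) (x y : n.-tuple bool) : option nat :=
  emin (fun m => exists P : protocol n,
    [/\ total P, ele (protocol_C U P) (Some alpha) & m = CCP f P x y]).

Definition I (n : nat) (x y : n.-tuple bool) : seq bool := y.

Lemma mem_inputs n (x : n.-tuple bool) : x \in inputs n.
Proof.
elim: n x => [|n IHn] x; first by rewrite tuple0.
case/tupleP: x => b w; apply/allpairsP; exists (b, w).
by split; rewrite ?IHn //; case: (b).
Qed.

Lemma code_bit_inj a b s t :
  code_bit a ++ s = code_bit b ++ t -> a = b /\ s = t.
Proof. by case: a => [a|]; case: b => [b|] //= e; case: e => *; subst. Qed.

Lemma code_string_inj a b s t :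
  code_string a ++ s = code_string b ++ t -> a = b /\ s = t.
Proof.
case: a => [a|]; case: b => [b|] //=; last by case=> ->.
case; elim: a b => [|c a IHa] [|d b] //=; first by case=> ->.
by case=> -> /IHa[[-> ->]].
Qed.

Lemma code_table_inj (T : Type) (code : T -> seq bool) n
    (f g : {ffun n.-tuple bool -> T}) s t :
  (forall a b u v, code a ++ u = code b ++ v -> a = b /\ u = v) ->
  flatten [seq code (f x) | x <- inputs n] ++ s =
  flatten [seq code (g x) | x <- inputs n] ++ t -> f = g /\ s = t.
Proof.
move=> code_inj e.
suff [fg ->]: {in inputs n, f =1 g} /\ s = t.
  by split=> //; apply/ffunP => x; exact/fg/mem_inputs.
elim: (inputs n) e => [|x r IHr] //=; rewrite -!catA.
case/code_inj => fgx /IHr[fg ->]; split=> // z.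
by rewrite inE => /predU1P[->|/fg].
Qed.

Lemma encode_inj n : injective (@encode n).
Proof.
suff encode_cat (P Q : protocol n) s t :
    encode P ++ s = encode Q ++ t -> P = Q /\ s = t.
  by move=> P Q e; have [] := encode_cat P Q [::] [::] (congr1 (cat^~ _) e).
elim: P Q s t => [f|f P0 IH0 P1 IH1|f P0 IH0 P1 IH1] [g|g Q0 Q1|g Q0 Q1] s t //=.
- by case=> /(code_table_inj code_string_inj)[-> ->].
- case; rewrite -!catA => /(code_table_inj code_bit_inj)[->].
  by case/IH0 => -> /IH1[-> ->].
- case; rewrite -!catA => /(code_table_inj code_bit_inj)[->].
  by case/IH0 => -> /IH1[-> ->].
Qed.

(* Main.v *)
Require Import Defs.
From mathcomp Require Import all_boot.
From mathcomp Require Import boolp.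

Set Implicit Arguments.
Unset Strict Implicit.
Unset Printing Implicit Defensive.

(** Fix [x].  A program of at most [alpha] bits for the protocol and the bits sent by
    Bob, padded to length [n - alpha.+1], determine the value that Alice outputs.  With
    the program [q] padded to [0^k 1 q] of length [alpha.+1], these pairs are
    indexed by the [n]-bit strings other than [0^n], so some [n]-bit [y] is not
    the value of any pair, and [CC(x, y) >= n - alpha] for it.

    Such a [y] can be computed from [x] and [alpha.+1] bits, namely the padded
    program [q] that takes longest to halt among those of length at most [alpha]:
    the running time of [q] is long enough to run all of them.  A program that
    has not halted by then, or that does not yield a total protocol, contributes
    junk values, but the number of pairs stays below [2^n].  If none of the
    programs halts, [y = x] will do.

    To obtain a Turing machine for this algorithm, values are coded as binary
    trees, written in preorder on a tape used as a stack of bits; a function is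
    computable if some four-tape machine replaces the topmost tree by its image,
    whatever lies below it. *)

(** * Runs of a machine as chains of steps *)

Inductive steps (M : machine) (c : config M) : config M -> Prop :=
| steps_refl : steps c c
| steps_step c1 c2 : step c = Some c1 -> steps c1 c2 -> steps c c2.

Lemma steps_trans (M : machine) (c1 c2 c3 : config M) :
  steps c1 c2 -> steps c2 c3 -> steps c1 c3.
Proof. by elim=> // c c' c'' e _ IH /IH; apply: steps_step. Qed.

Lemma steps_iter (M : machine) (c c' : config M) :
  steps c c' -> exists t, iter t (obind (@step M)) (Some c) = Some c'.
Proof.
elim=> [c0|c0 c1 c2 e _ [t et]]; first by exists 0.
by exists t.+1; rewrite iterSr /= e.
Qed.

(** * Four-tape machines as stack machines *)

Record frag := Frag {
  fstate : finType;
  fstart : fstate;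
  fdelta : fstate -> {ffun 'I_4 -> symbol} ->
           option (fstate * {ffun 'I_4 -> symbol * move}) }.

Coercion machine_of (F : frag) : machine :=
  @Machine (fstate F) (fstart F) 2 (@fdelta F).

Definition tapes := {ffun 'I_4 -> tape}.

(* The top of the stack is under the head. *)
Definition stack_tape (t : tape) (s : seq bool) : Prop :=
  exists a b, t = (nseq a None, map Some s ++ nseq b None).

Definition holds (tp : tapes) (s : seq (seq bool)) : Prop :=
  forall i : 'I_4, stack_tape (tp i) (nth [::] s i).

Definition tops (s : seq (seq bool)) : {ffun 'I_4 -> symbol} :=
  [ffun i : 'I_4 => ohead (nth [::] s i)].

Lemma scan_stack t s : stack_tape t s -> scan t = ohead s.
Proof. by case=> a [b ->]; case: s => //; case: b. Qed.

Lemma scan_holds (tp : tapes) s : holds tp s -> [ffun i => scan (tp i)] = tops s.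
Proof. by move=> h; apply/ffunP => i; rewrite !ffunE; apply: scan_stack. Qed.

Lemma stack_stay t s : stack_tape t s -> stack_tape (write_move t (scan t, Stay)) s.
Proof.
case=> a [b ->]; case: s => [|x s]; last by exists a, b.
by exists a, b.-1.+1; case: b.
Qed.

Lemma stack_pop t s :
  stack_tape t s -> stack_tape (write_move t (None, MoveR)) (behead s).
Proof.
case=> a [b ->]; case: s => [|x s]; last by exists a.+1, b.
by exists a.+1, b.-1; case: b.
Qed.

Lemma stack_push t s b : stack_tape t s ->
  stack_tape (write_move (write_move t (scan t, MoveL)) (Some b, Stay)) (b :: s).
Proof.
case=> a [d ->]; exists a.-1.
case: s => [|x s]; first by exists d.-1.+1; case: d; case: a.
by exists d; case: a.
Qed.

(** Halting is expressed through [tops s']: the stacks determine the tapes only up to surrounding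
    blanks, but they do determine the scanned symbols, on which control flow depends. *)
Definition run (F : frag) (s s' : seq (seq bool)) : Prop :=
  forall tp : tapes, holds tp s ->
  exists q, exists2 tp' : tapes,
    steps (M := F) (fstart F, tp) (q, tp') & fdelta q (tops s') = None /\ holds tp' s'.

Definition upd (s : seq (seq bool)) (i : nat) (v : seq bool) := set_nth [::] s i v.

Definition skip : frag := @Frag unit tt (fun _ _ => None).

Lemma run_skip s : run skip s s.
Proof. by move=> tp h; exists tt, tp; [apply: steps_refl|]. Qed.

Definition only (i : 'I_4) (sc : {ffun 'I_4 -> symbol}) (a : symbol * move) :
    {ffun 'I_4 -> symbol * move} :=
  [ffun j => if j == i then a else (sc j, Stay)].

Definition pop (i : 'I_4) : frag :=
  @Frag bool false (fun q sc => if q then None else Some (true, only i sc (None, MoveR))).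

Lemma run_pop i s : run (pop i) s (upd s i (behead (nth [::] s i))).
Proof.
move=> tp h; exists true; eexists.
  by apply: steps_step; [reflexivity | apply: steps_refl].
split=> //= j; rewrite /upd nth_set_nth /= !ffunE val_eqE.
by case: eqP => [->|_]; [apply: stack_pop | apply: stack_stay].
Qed.

Definition push (i : 'I_4) (b : bool) : frag :=
  @Frag (option bool) None (fun q sc =>
    match q with
    | None => Some (Some false, only i sc (sc i, MoveL))
    | Some false => Some (Some true, only i sc (Some b, Stay))
    | Some true => None
    end).

Lemma run_push i b s : run (push i b) s (upd s i (b :: nth [::] s i)).
Proof.
move=> tp h; exists (Some true); eexists.
  by apply: steps_step; [reflexivity | apply: steps_step; [reflexivity | apply: steps_refl]].
split=> //= j; rewrite /upd nth_set_nth /= !ffunE val_eqE.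
case: eqP => [->|_]; first exact: stack_push.
by do 2!apply: stack_stay.
Qed.

(** * Control-flow graphs whose nodes are fragments *)

Section Flow.
Variables (J : finType) (F : J -> frag) (next : J -> {ffun 'I_4 -> symbol} -> option J).

(** A state is a node together with a state of its fragment. When that fragment has no transition
    left, one idle step enters the node chosen by [next]; if there is none, the whole machine
    halts. *)
Definition flow (j0 : J) : frag :=
  @Frag {j : J & fstate (F j)} (existT _ j0 (fstart (F j0)))
    (fun u sc =>
       match fdelta (projT2 u) sc with
       | Some a => Some (existT _ (projT1 u) a.1, a.2)
       | None => omap (fun j => (existT _ j (fstart (F j)), [ffun k => (sc k, Stay)]))
                      (next (projT1 u) sc)
       end).

Inductive flows : J -> seq (seq bool) -> seq (seq bool) -> Prop :=
| flows_halt j s s' : run (F j) s s' -> next j (tops s') = None -> flows j s s'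
| flows_next j k s s1 s' :
    run (F j) s s1 -> next j (tops s1) = Some k -> flows k s1 s' -> flows j s s'.

Lemma flow_steps j0 j (c c' : config (F j)) :
  steps c c' ->
  steps (M := flow j0) (existT _ j c.1, c.2) (existT _ j c'.1, c'.2).
Proof.
elim=> [c0|c0 c1 c2 e _ IH]; first exact: steps_refl.
apply: steps_step IH; move: e; rewrite /step /=.
by case: (fdelta _ _) => //= a [<-].
Qed.

Lemma flows_run j s s' : flows j s s' -> run (flow j) s s'.
Proof.
(* The entry node [j0], a parameter of the machine, stays fixed while the current node moves along
   the induction. *)
suff gen j0 : flows j s s' -> forall tp : tapes, holds tp s ->
    exists q, exists2 tp' : tapes,
      steps (M := flow j0) (existT _ j (fstart (F j)), tp) (q, tp') &
      fdelta (f := flow j0) q (tops s') = None /\ holds tp' s'.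
  by move=> f tp h; apply: gen.
elim=> {j s s'} [j s s' r e tp h|j k s s1 s' r e _ IH tp h].
  have [q [tp' st [hl h']]] := r _ h.
  exists (existT _ j q), tp'; first exact: (flow_steps j0 st).
  by split=> //=; rewrite hl e.
have [q [tp' st [hl h']]] := r _ h.
have [|q2 [tp2 st2 hs2]] := IH [ffun i => write_move (tp' i) (scan (tp' i), Stay)].
  by move=> i; rewrite ffunE; apply: stack_stay.
exists q2, tp2 => //; apply: steps_trans (flow_steps j0 st) _.
apply: steps_step st2; rewrite /step /= (scan_holds h') hl e /=.
by congr (Some (_, _)); apply/ffunP => i; rewrite !ffunE (scan_stack (h' i)).
Qed.

End Flow.

Definition seqf (F G : frag) : frag :=
  flow (fun b : bool => if b then G else F)
       (fun b _ => if b then None else Some true) false.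

Lemma run_seq F G s s1 s2 : run F s s1 -> run G s1 s2 -> run (seqf F G) s s2.
Proof.
move=> rF rG; apply: flows_run.
by apply: (@flows_next _ _ _ _ true _ s1) => //; apply: flows_halt.
Qed.

Definition test (P : pred symbol) (i : 'I_4) (s : seq (seq bool)) : bool :=
  P (ohead (nth [::] s i)).

Definition iff (P : pred symbol) (i : 'I_4) (F G : frag) : frag :=
  flow (fun j : option bool => if j is Some b then if b then F else G else skip)
       (fun j sc => if j is None then Some (Some (P (sc i))) else None) None.

Lemma run_if P i F G s s' :
  run (if test P i s then F else G) s s' -> run (iff P i F G) s s'.
Proof.
move=> r; apply: flows_run.
apply: (@flows_next _ _ _ _ (Some (test P i s)) _ s) => //; first exact: run_skip.
  by rewrite /tops ffunE.
exact: flows_halt.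
Qed.

Definition while (P : pred symbol) (i : 'I_4) (F : frag) : frag :=
  flow (fun b : bool => if b then F else skip)
       (fun b sc => if b then Some false else if P (sc i) then Some true else None) false.

Inductive whiles (P : pred symbol) (i : 'I_4) (F : frag) (s : seq (seq bool)) :
    seq (seq bool) -> Prop :=
| whiles_stop : ~~ test P i s -> whiles P i F s s
| whiles_next s1 s' :
    test P i s -> run F s s1 -> whiles P i F s1 s' -> whiles P i F s s'.

Lemma run_while P i F s s' : whiles P i F s s' -> run (while P i F) s s'.
Proof.
move=> w; apply: flows_run.
elim: w => {s s'} [s /negPf e|s s1 s' e r _ IH].
  by apply: flows_halt; [apply: run_skip | rewrite ffunE -/(test P i s) e].
apply: (@flows_next _ _ _ _ true _ s); first exact: run_skip.
  by rewrite ffunE -/(test P i s) e.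
by apply: flows_next IH; [exact: r|].
Qed.

Definition t0 : 'I_4 := @Ordinal 4 0 isT.
Definition t1 : 'I_4 := @Ordinal 4 1 isT.
Definition t2 : 'I_4 := @Ordinal 4 2 isT.
Definition t3 : 'I_4 := @Ordinal 4 3 isT.

Definition is1 (a : symbol) : bool := a == Some true.

Definition drain (i : 'I_4) (f : bool -> frag) : frag :=
  while isSome i (iff is1 i (seqf (pop i) (f true)) (seqf (pop i) (f false))).

(** [S u w] is the loop invariant: it gives all stacks when [u], latest bit first, has been
    processed and [w] remains on tape [i]. *)
Lemma run_drain (i : 'I_4) f (S : seq bool -> seq bool -> seq (seq bool)) :
  (forall u w, nth [::] (S u w) i = w) ->
  (forall u b w, run (f b) (upd (S u (b :: w)) i w) (S (b :: u) w)) ->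
  forall w u, run (drain i f) (S u w) (S (catrev w u) [::]).
Proof.
move=> Si Sf w u; apply: run_while.
elim: w u => [|b w IHw] u; first by apply: whiles_stop; rewrite /test Si.
apply: whiles_next (IHw (b :: u)); first by rewrite /test Si.
apply: run_if; rewrite /test Si.
have r := @run_pop i (S u (b :: w)); rewrite Si /= in r.
by case: b r => r; apply: run_seq r _; apply: Sf.
Qed.

(** * Trees on the stack of tape 0 *)

Inductive tree := Leaf | Node of tree & tree.

Fixpoint tcode (t : tree) : seq bool :=
  if t is Node a b then true :: tcode a ++ tcode b else [:: false].

Definition parse (j : 'I_4) : frag :=
  seqf (push t2 true)
    (while isSome t2
       (iff is1 t0 (seqf (pop t0) (seqf (push j true) (push t2 true)))
                   (seqf (pop t0) (seqf (push j false) (pop t2))))).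

Ltac run_prim := match goal with
  | |- run (pop _) _ _ => exact: run_pop
  | |- run (push _ _) _ _ => exact: run_push
  | |- run skip _ _ => exact: run_skip
  end.
Ltac run_auto := rewrite /upd /=; match goal with
  | |- run (seqf _ _) _ _ => apply: run_seq; [run_auto | run_auto]
  | |- run (iff _ _ _ _) _ _ => apply: run_if; run_auto
  | |- run _ _ _ => run_prim
  end.

(* The counter on tape 2 is the number of trees that remain to be read. *)
Lemma run_parse (j : bool) t m d :
  run (parse (if j then t1 else t3))
    (if j then [:: tcode t ++ m; [::]; [::]; d] else [:: tcode t ++ m; d; [::]; [::]])
    (if j then [:: m; rev (tcode t); [::]; d] else [:: m; d; [::]; rev (tcode t)]).
Proof.
pose S m k a := if j then [:: m; a; k; d] else [:: m; d; k; a].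
pose W := whiles isSome t2
       (iff is1 t0 (seqf (pop t0) (seqf (push (if j then t1 else t3) true) (push t2 true)))
                   (seqf (pop t0) (seqf (push (if j then t1 else t3) false) (pop t2)))).
(* Continuation form: a run of the loop from the situation after a tree yields one from the
   situation before it. Two subtrees in a row are then handled by applying both induction
   hypotheses. *)
suff main k a s' : W (S m k (catrev (tcode t) a)) s' ->
    W (S (tcode t ++ m) (true :: k) a) s'.
  apply: (@run_seq _ _ _ (S (tcode t ++ m) [:: true] [::])).
    by rewrite /S; case: (j); apply: run_push.
  apply: run_while; apply: main; rewrite /S /rev.
  by case: (j); apply: whiles_stop.
elim: t m k a => [|l IHl r IHr] m k a w.
  apply: whiles_next w; first by rewrite /S; case: (j).
  by rewrite /S; case: (j); run_auto.
apply: (@whiles_next _ _ _ _ (S (tcode l ++ tcode r ++ m) [:: true, true & k] (true :: a))).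
- by rewrite /S; case: (j).
- by rewrite /S catA; case: (j); run_auto.
- by apply: IHl; apply: IHr; move: w; rewrite /= -catrev_catl.
Qed.

Definition transfer i j : frag := drain i (push j).

Lemma run_transfer10 m w k d :
  run (transfer t1 t0) [:: m; w; k; d] [:: rev w ++ m; [::]; k; d].
Proof.
by apply: (@run_drain t1 _ (fun u v => [:: u ++ m; v; k; d]) _ _ w [::]) => // *; run_auto.
Qed.

Lemma run_transfer30 m w k d :
  run (transfer t3 t0) [:: m; w; k; d] [:: rev d ++ m; w; k; [::]].
Proof.
by apply: (@run_drain t3 _ (fun u v => [:: u ++ m; w; k; v]) _ _ d [::]) => // *; run_auto.
Qed.

Lemma run_transfer31 m w k d :
  run (transfer t3 t1) [:: m; w; k; d] [:: m; rev d ++ w; k; [::]].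
Proof.
by apply: (@run_drain t3 _ (fun u v => [:: m; u ++ w; k; v]) _ _ d [::]) => // *; run_auto.
Qed.

Lemma run_transfer03 m w k d :
  run (transfer t0 t3) [:: m; w; k; d] [:: [::]; w; k; rev m ++ d].
Proof.
by apply: (@run_drain t0 _ (fun u v => [:: v; w; k; u ++ d]) _ _ m [::]) => // *; run_auto.
Qed.

Lemma run_transfer12 m w k d :
  run (transfer t1 t2) [:: m; w; k; d] [:: m; [::]; rev w ++ k; d].
Proof.
by apply: (@run_drain t1 _ (fun u v => [:: m; v; u ++ k; d]) _ _ w [::]) => // *; run_auto.
Qed.

Definition main m : seq (seq bool) := [:: m; [::]; [::]; [::]].

Definition drop_tree : frag := seqf (parse t1) (drain t1 (fun=> skip)).

Lemma run_drop t m : run drop_tree (main (tcode t ++ m)) (main m).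
Proof.
apply: run_seq; first exact: (@run_parse true t m [::]).
by apply: (@run_drain t1 _ (fun u v => [:: m; v; [::]; [::]]) _ _ _ [::]) => // *; run_auto.
Qed.

(** Every transfer reverses a code. The copy on tape 3 is already in the right order, so it returns
    through tape 1 and is reversed twice. *)
Definition dup_tree : frag :=
  seqf (parse t1)
    (seqf (drain t1 (fun b => seqf (push t0 b) (push t3 b)))
       (seqf (transfer t3 t1) (transfer t1 t0))).

Lemma run_dup t m :
  run dup_tree (main (tcode t ++ m)) (main (tcode t ++ tcode t ++ m)).
Proof.
apply: run_seq; first exact: (@run_parse true t m [::]).
apply: (@run_seq _ _ _ [:: tcode t ++ m; [::]; [::]; tcode t]).
  rewrite -{2 3}(revK (tcode t)).
  by apply: (@run_drain t1 _ (fun u v => [:: u ++ m; v; [::]; u]) _ _ _ [::]) => // *; run_auto.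
apply: run_seq; first exact: run_transfer31.
by rewrite cats0 -{3}(revK (tcode t)); apply: run_transfer10.
Qed.

Definition swap_tree : frag :=
  seqf (parse t3) (seqf (parse t1) (seqf (transfer t3 t0) (transfer t1 t0))).

Lemma run_swap t u m :
  run swap_tree (main (tcode t ++ tcode u ++ m)) (main (tcode u ++ tcode t ++ m)).
Proof.
apply: run_seq; first exact: (@run_parse false t (tcode u ++ m) [::]).
apply: run_seq; first exact: (@run_parse true u m _).
apply: run_seq; first exact: run_transfer30.
by rewrite revK -{2}(revK (tcode u)); apply: run_transfer10.
Qed.

(** * Computable functions *)

Fixpoint pushes (w : seq bool) : frag :=
  if w is b :: w' then seqf (pushes w') (push t0 b) else skip.

Lemma run_pushes w m s : run (pushes w) (m :: s) ((w ++ m) :: s).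
Proof.
elim: w => [|b w IHw] /=; first exact: run_skip.
by apply: run_seq IHw _; apply: run_push.
Qed.

Class Enc (A : Type) := enc : A -> tree.

Definition computable (A B : Type) (eA : Enc A) (eB : Enc B) (f : A -> B) : Prop :=
  exists F : frag, forall a m,
    run F (main (tcode (enc a) ++ m)) (main (tcode (enc (f a)) ++ m)).
Arguments computable {A B eA eB} f.

#[local] Instance enc_tree : Enc tree := id.
#[local] Instance enc_bool : Enc bool := fun b => if b then Node Leaf Leaf else Leaf.
#[local] Instance enc_prod (A B : Type) (eA : Enc A) (eB : Enc B) : Enc (A * B) :=
  fun p => Node (enc p.1) (enc p.2).
#[local] Instance enc_option (A : Type) (eA : Enc A) : Enc (option A) :=
  fun o => if o is Some a then Node Leaf (enc a) else Leaf.
#[local] Instance enc_seq (A : Type) (eA : Enc A) : Enc (seq A) :=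
  foldr (fun a t => Node (enc a) t) Leaf.
#[local] Instance enc_ffun (k : nat) (A : Type) (eA : Enc A) : Enc {ffun 'I_k -> A} :=
  fun f => enc [seq f i | i <- enum 'I_k].

Section Computable.
Context {E A B C : Type} {eE : Enc E} {eA : Enc A} {eB : Enc B} {eC : Enc C}.

(** Machines see only codes, so computability passes between types whose codes agree. With
    [g := enc] a function is reduced to one on trees; with [g := id] only the type of the result
    changes. *)
Lemma comp_enc (f : A -> B) (F : E -> C) (g : A -> E) :
  (forall a, enc (g a) = enc a) -> (forall a, enc (F (g a)) = enc (f a)) ->
  computable F -> computable f.
Proof. by move=> eg ef [M hM]; exists M => a m; rewrite -ef -eg; apply: hM. Qed.

Lemma comp_eq (f g : A -> B) : f =1 g -> computable f -> computable g.
Proof. by move=> e [M hM]; exists M => a m; rewrite -e; apply: hM. Qed.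

Lemma comp_id : computable (fun a : A => a).
Proof. by exists skip => a m; apply: run_skip. Qed.

Lemma comp_comp (g : A -> B) (f : E -> A) :
  computable g -> computable f -> computable (fun e => g (f e)).
Proof.
move=> [G hG] [F hF]; exists (seqf F G) => e m.
exact: run_seq (hF _ _) (hG _ _).
Qed.

(** The argument is duplicated, [g] acts on the upper copy and, after a swap, [f] on the other one;
    the last bit pushed is the mark of a [Node]. *)
Lemma comp_pair (f : E -> A) (g : E -> B) :
  computable f -> computable g -> computable (fun e => (f e, g e)).
Proof.
move=> [F hF] [G hG].
exists (seqf dup_tree (seqf G (seqf swap_tree (seqf F (push t0 true))))) => e m.
apply: run_seq; first exact: run_dup.
apply: run_seq; first exact: hG.
apply: run_seq; first exact: run_swap.
apply: run_seq; first exact: hF.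
by rewrite /= -catA; apply: run_push.
Qed.

(* Since [Leaf] codes [false], [None] and [[::]], this is the common form of the
   case analyses on booleans, options and lists. *)
Lemma comp_case (s : E -> A) (f : E -> C) (g : E * B -> C) (h : E -> C) :
  (forall e, (enc (s e) = Leaf /\ h e = f e) \/
             (exists b, [/\ enc (s e) = enc b, enc b <> Leaf & h e = g (e, b)])) ->
  computable s -> computable f -> computable g -> computable h.
Proof.
move=> hP [S hS] [F hF] [G hG].
exists (seqf dup_tree (seqf S (iff is1 t0
          (seqf swap_tree (seqf (push t0 true) G)) (seqf (pop t0) F)))) => e m.
apply: run_seq; first exact: run_dup.
apply: run_seq; first exact: hS.
case: (hP e) => [[-> ->]|[b [-> nb ->]]]; apply: run_if.
  by apply: run_seq; [apply: run_pop | apply: hF].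
have -> : test is1 t0 (main (tcode (enc b) ++ tcode (enc e) ++ m)).
  by case: (enc b) nb.
apply: run_seq; first exact: run_swap.
apply: run_seq; first exact: run_push.
by rewrite /upd /= catA; apply: (hG (e, b)).
Qed.

Lemma comp_const (b : B) : computable (fun _ : E => b).
Proof.
exists (seqf drop_tree (pushes (tcode (enc b)))) => e m.
by apply: run_seq; [apply: run_drop | apply: run_pushes].
Qed.

Inductive loops (f : A -> bool * A) (a : A) : A -> Prop :=
| loops_stop a' : f a = (false, a') -> loops f a a'
| loops_next a1 a' : f a = (true, a1) -> loops f a1 a' -> loops f a a'.

(** No bound on the number of rounds is given in advance. This is what allows a machine to wait
    until a program halts. *)
Lemma comp_loop (f : A -> bool * A) : computable f ->
  exists F : frag, forall a a' m, loops f a a' ->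
    run F (main (tcode (enc a) ++ m)) (main (tcode (enc a') ++ m)).
Proof.
move=> [F hF]; pose G := seqf F (pop t0).
have hG a m : run G (main (tcode (enc a) ++ m))
    (main (tcode (enc (f a).1) ++ tcode (enc (f a).2) ++ m)).
  by apply: run_seq (hF _ _) _; rewrite /= catA; apply: run_pop.
(* The code of [true] is 100 and that of [false] is 0, so the top bit is the flag; three pops remove
   the first code and one pop the second. *)
exists (seqf G (seqf (while is1 t0 (seqf (pop t0) (seqf (pop t0) (seqf (pop t0) G))))
          (pop t0))) => a a' m l.
apply: run_seq (hG _ _) _.
apply: (@run_seq _ _ _ (main (false :: tcode (enc a') ++ m))); last exact: run_pop.
apply: run_while; elim: l => {a a'} [a a' -> | a a1 a' -> _ IH].
  exact: whiles_stop.
apply: whiles_next IH => //.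
apply: run_seq; first exact: run_pop.
apply: run_seq; first exact: run_pop.
apply: run_seq; first exact: run_pop.
exact: hG.
Qed.

End Computable.

Lemma comp_thd : computable (fun t : tree => if t is Node a _ then a else Leaf).
Proof.
exists (iff is1 t0 (seqf (pop t0) (seqf swap_tree drop_tree)) skip) => t m.
apply: run_if; case: t => [|a b]; first exact: run_skip.
apply: run_seq; first exact: run_pop.
rewrite /upd /= -catA; apply: run_seq; first exact: run_swap.
exact: run_drop.
Qed.

Lemma comp_ttl : computable (fun t : tree => if t is Node _ b then b else Leaf).
Proof.
exists (iff is1 t0 (seqf (pop t0) drop_tree) skip) => t m.
apply: run_if; case: t => [|a b]; first exact: run_skip.
apply: run_seq; first exact: run_pop.
by rewrite /upd /= -catA; apply: run_drop.
Qed.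

Section Projections.
Context {E A B : Type} {eE : Enc E} {eA : Enc A} {eB : Enc B}.

Lemma comp_fst (f : E -> A * B) : computable f -> computable (fun e => (f e).1).
Proof.
apply: (@comp_comp _ _ _ _ _ _ fst); exact: (comp_enc (g := enc) _ _ comp_thd).
Qed.

Lemma comp_snd (f : E -> A * B) : computable f -> computable (fun e => (f e).2).
Proof.
apply: (@comp_comp _ _ _ _ _ _ snd); exact: (comp_enc (g := enc) _ _ comp_ttl).
Qed.

End Projections.

Section Cases.
Context {E A B C : Type} {eE : Enc E} {eA : Enc A} {eB : Enc B} {eC : Enc C}.

Lemma comp_cons (f : E -> A) (g : E -> seq A) :
  computable f -> computable g -> computable (fun e => f e :: g e).
Proof.
by move=> hf hg; apply: (comp_enc (g := id) _ _ (comp_pair hf hg)).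
Qed.

Lemma comp_some (f : E -> A) : computable f -> computable (fun e => Some (f e)).
Proof.
by move=> hf; apply: (comp_enc (g := id) _ _ (comp_pair (comp_const false) hf)).
Qed.

Lemma comp_if (b : E -> bool) (f g : E -> C) :
  computable b -> computable f -> computable g ->
  computable (fun e => if b e then f e else g e).
Proof.
move=> hb hf hg.
apply: (comp_case (g := fun p : E * bool => f p.1) _ hb hg).
  by move=> e; case: (b e); [right; exists true | left].
by apply: (comp_comp hf); apply: comp_fst; apply: comp_id.
Qed.

Lemma comp_option (o : E -> option A) (f : E -> C) (g : E -> A -> C) :
  computable o -> computable f -> computable (fun q : E * A => g q.1 q.2) ->
  computable (fun e => if o e is Some a then g e a else f e).
Proof.
move=> ho hf hg.
(* [Some a] has the same code as the pair [(false, a)]. *)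
apply: (comp_case (g := fun p : E * (bool * A) => g p.1 p.2.2) _ ho hf).
  by move=> e; case: (o e) => [a|]; [right; exists (false, a) | left].
apply: (comp_comp hg (f := fun p : E * (bool * A) => (p.1, p.2.2))).
apply: comp_pair; first by apply: comp_fst; apply: comp_id.
by do 2!apply: comp_snd; apply: comp_id.
Qed.

Lemma comp_seq (s : E -> seq A) (f : E -> C) (g : E -> A -> seq A -> C) :
  computable s -> computable f ->
  computable (fun q : E * (A * seq A) => g q.1 q.2.1 q.2.2) ->
  computable (fun e => if s e is a :: r then g e a r else f e).
Proof.
move=> hs hf hg; apply: (comp_case _ hs hf hg).
by move=> e; case: (s e) => [|a r]; [left | right; exists (a, r)].
Qed.

End Cases.

(** [comp] proves computability by following the syntax of the function; the hook is redefined as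
    closure under further operations becomes available. *)
Ltac comp_hook := fail.
Ltac comp_step := match goal with
  | _ => assumption
  | |- computable id => exact: comp_id
  | |- computable fst => apply: (comp_fst comp_id)
  | |- computable snd => apply: (comp_snd comp_id)
  | |- computable (pair ?a) => apply: (comp_pair (comp_const a) comp_id)
  | |- computable (fun e => e) => exact: comp_id
  | |- computable (fun _ => ?b) => exact: comp_const
  | H : computable ?h |- computable (fun e => ?h _) => apply: (comp_comp H)
  | |- computable (fun e => fst _) => apply: comp_fst
  | |- computable (fun e => snd _) => apply: comp_snd
  | |- computable (fun e => (_, _)) => apply: comp_pair
  | |- computable (fun e => _ :: _) => apply: comp_cons
  | |- computable (fun e => Some _) => apply: comp_some
  | |- computable (fun e => match _ with _ => _ end) =>
      first [apply: comp_if | apply: comp_option | apply: comp_seq]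
  | _ => comp_hook
  end.
Ltac comp := cbv zeta; repeat comp_step.

(** * Folds and the list functions derived from them *)

Section Folds.
Context {E A B : Type} {eE : Enc E} {eA : Enc A} {eB : Enc B}.

Lemma comp_foldl (g : E -> B -> A -> B) (b : E -> B) (s : E -> seq A) :
  computable (fun q : E * (B * A) => g q.1 q.2.1 q.2.2) ->
  computable b -> computable s ->
  computable (fun e => foldl (g e) (b e) (s e)).
Proof.
move=> hg hb hs.
pose f (q : E * (B * seq A)) :=
  if q.2.2 is a :: r then (true, (q.1, (g q.1 q.2.1 a, r))) else (false, q).
have hf : computable f.
  rewrite /f; apply: comp_seq; comp.
  apply: (comp_comp hg (f := fun q : E * (B * seq A) * (A * seq A) =>
    (q.1.1, (q.1.2.1, q.2.1)))).
  by comp.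
have [L hL] := comp_loop hf.
have [I hI] : computable (fun e => (e, (b e, s e))) by comp.
have [O hO] : computable (fun q : E * (B * seq A) => q.2.1) by comp.
exists (seqf I (seqf L O)) => e m.
apply: run_seq (hI _ _) _.
apply: (run_seq _ (hO (e, (foldl (g e) (b e) (s e), [::])) m)); apply: hL.
elim: (s e) (b e) => [|a r IHr] c /=; first exact: loops_stop.
by apply: loops_next (IHr _).
Qed.

End Folds.
Ltac comp_hook ::= match goal with
  | |- computable (fun e => foldl _ _ _) => apply: comp_foldl
  end.

Section Lists.
Context {E A B : Type} {eE : Enc E} {eA : Enc A} {eB : Enc B}.

Lemma comp_rev (s : E -> seq A) : computable s -> computable (fun e => rev (s e)).
Proof.
move=> hs.
apply: (@comp_eq _ _ _ _ (fun e => foldl (fun r a => a :: r) [::] (s e))); last by comp.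
by move=> e; rewrite -[RHS]cats0 -catrevE; elim: (s e) [::] => //=.
Qed.

End Lists.

Section CatMap.
Context {E A B : Type} {eE : Enc E} {eA : Enc A} {eB : Enc B}.

Lemma comp_cat (s t : E -> seq A) :
  computable s -> computable t -> computable (fun e => s e ++ t e).
Proof.
move=> hs ht.
apply: (@comp_eq _ _ _ _ (fun e => foldl (fun r a => a :: r) (t e) (rev (s e)))).
  move=> e; rewrite -[s e in RHS]revK -catrevE.
  by elim: (rev (s e)) (t e) => //=.
by comp; apply: comp_rev.
Qed.

Lemma comp_map (g : E -> A -> B) (s : E -> seq A) :
  computable (fun q : E * A => g q.1 q.2) -> computable s ->
  computable (fun e => [seq g e a | a <- s e]).
Proof.
move=> hg hs.
apply: (@comp_eq _ _ _ _ (fun e => rev (foldl (fun r a => g e a :: r) [::] (s e)))).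
  move=> e; rewrite -[RHS]revK -map_rev; congr rev.
  by elim/last_ind: (s e) => //= r a IHr; rewrite rev_rcons foldl_rcons /= IHr.
apply: comp_rev; comp.
by apply: (comp_comp hg (f := fun q : E * (seq B * A) => (q.1, q.2.2))); comp.
Qed.

End CatMap.

Ltac comp_lists := match goal with
  | |- computable (fun e => foldl _ _ _) => apply: comp_foldl
  | |- computable (fun e => rev _) => apply: comp_rev
  | |- computable (fun e => _ ++ _) => apply: comp_cat
  | |- computable (fun e => map _ _) => apply: comp_map
  end.
Ltac comp_hook ::= comp_lists.

(** * Equality tests, finite types and finite functions *)

Fixpoint eqt (t u : tree) : bool :=
  match t, u with
  | Leaf, Leaf => true
  | Node a b, Node c d => eqt a c && eqt b d
  | _, _ => false
  end.

Lemma eqtP t u : reflect (t = u) (eqt t u).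
Proof.
elim: t u => [|a IHa b IHb] [|c d] /=; try by constructor.
by apply: (iffP andP) => [[/IHa-> /IHb->]|[<- <-]] //; split; [apply/IHa | apply/IHb].
Qed.

Lemma comp_eqt (E : Type) (eE : Enc E) t (u : E -> tree) :
  computable u -> computable (fun e => eqt t (u e)).
Proof.
move=> hu; apply: (comp_comp _ hu) => {u hu}; elim: t => [|a IHa b IHb].
- apply: (comp_case (f := fun=> true) (g := fun _ : tree * tree => false) _ comp_id);
    try exact: comp_const.
  by case=> [|a b]; [left | right; exists (Node a b)].
- apply: (@comp_eq _ _ _ _ (fun u : tree =>
     if (if eqt Leaf u then true else false) then false else
     if eqt a (if u is Node c _ then c else Leaf) then
        eqt b (if u is Node _ d then d else Leaf) else false)).
    by case=> //= c d; case: eqt.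
  apply: comp_if; comp.
    apply: (comp_case (f := fun=> true) (g := fun _ : tree * tree => false) _ comp_id);
    try exact: comp_const.
    by case=> [|c d]; [left | right; exists (Node c d)].
  + exact: comp_thd.
  + exact: comp_ttl.
Qed.

(** Such a function is a finite table, that is, a nest of comparisons with fixed codes. The
    transition function of a machine is treated in this way. *)
Lemma comp_finite (T : finType) (eT : Enc T) (B : Type) (eB : Enc B) (f : T -> B) :
  injective (enc : T -> tree) -> computable f.
Proof.
move=> inj; case: (pickP T) => [x0 _|T0]; last first.
  by exists skip => a; have := T0 a; rewrite inE.
apply: (@comp_eq _ _ _ _ (fun x : T =>
    foldr (fun a b => if eqt (enc a) (enc x) then f a else b) (f x0) (enum T))).
  move=> x; have: x \in enum T by rewrite mem_enum.
  elim: (enum T) => //= a r IHr; rewrite inE.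
  case: eqtP => [/inj -> //|ne]; case: eqP => [xa|_]; last exact: IHr.
  by case: ne; rewrite xa.
elim: (enum T) => [|a r IHr] /=; first by comp.
apply: comp_if; comp => //; apply: comp_eqt.
exact: (comp_enc (g := id) _ _ (comp_id (A := T))).
Qed.

Lemma enc_bool_inj : injective (enc : bool -> tree).
Proof. by do 2!case. Qed.

Lemma enc_option_inj (A : Type) (eA : Enc A) :
  injective (enc : A -> tree) -> injective (enc : option A -> tree).
Proof. by move=> inj [a|] [b|] // [/inj->]. Qed.

Lemma enc_prod_inj (A B : Type) (eA : Enc A) (eB : Enc B) :
  injective (enc : A -> tree) -> injective (enc : B -> tree) ->
  injective (enc : A * B -> tree).
Proof. by move=> iA iB [a b] [c d] [/iA -> /iB ->]. Qed.

Lemma enc_seq_inj (A : Type) (eA : Enc A) :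
  injective (enc : A -> tree) -> injective (enc : seq A -> tree).
Proof. by move=> iA; elim=> [|a s IHs] [|b t] // [/iA-> /IHs->]. Qed.

Lemma enc_ffun_inj (k : nat) (A : Type) (eA : Enc A) :
  injective (enc : A -> tree) -> injective (enc : {ffun 'I_k -> A} -> tree).
Proof.
move=> iA f g /(enc_seq_inj iA) e; apply/ffunP => i.
have : i \in enum 'I_k by rewrite mem_enum.
elim: (enum 'I_k) e => //= j r IHr [e1 e2]; rewrite inE.
by case/orP => [/eqP->|/(IHr e2)].
Qed.

Section Ffun.
Context {E A : Type} {eE : Enc E} {eA : Enc A} (k : nat).

Lemma comp_ffun (f : 'I_k -> E -> A) :
  (forall i, computable (f i)) -> computable (fun e => [ffun i => f i e]).
Proof.
move=> hf; apply: (comp_enc (g := id) (F := fun e => [seq f i e | i <- enum 'I_k])) => //.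
  by move=> e; congr enc; apply: eq_map => i; rewrite ffunE.
by elim: (enum 'I_k) => [|i r IHr] /=; comp.
Qed.

Lemma comp_proj (f : E -> {ffun 'I_k -> A}) (i : 'I_k) :
  computable f -> computable (fun e => f e i).
Proof.
pose ttl t := if t is Node _ b then b else Leaf.
pose thd t := if t is Node a _ then a else Leaf.
apply: (@comp_comp _ _ _ _ _ _ (fun g : {ffun 'I_k -> A} => g i)).
apply: (comp_enc (g := enc) (F := fun t => thd (iter (index i (enum 'I_k)) ttl t))) => //.
  move=> g; rewrite /enc /enc_ffun; have: i \in enum 'I_k by rewrite mem_enum.
  elim: (enum 'I_k) => //= j r IHr; rewrite inE eq_sym.
  by case: eqVneq => [->|_] //= /IHr <-; rewrite -iterS iterSr.
apply: (comp_comp comp_thd); elim: (index _ _) => [|n IHn]; first exact: comp_id.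
exact: (comp_comp comp_ttl IHn).
Qed.

End Ffun.

(** * From the raw input to codes, and from codes to the raw output *)

Definition cons_bit (b : bool) : frag := pushes (true :: tcode (enc b)).

Lemma run_cons_bit (b : bool) (u m : seq bool) s :
  run (cons_bit b) ((tcode (enc u) ++ m) :: s) ((tcode (enc (b :: u)) ++ m) :: s).
Proof.
have -> : tcode (enc (b :: u)) ++ m = (true :: tcode (enc b)) ++ (tcode (enc u) ++ m).
  by rewrite /= catA.
exact: run_pushes.
Qed.

(** Both strings are first reversed onto other tapes, because the code of a list is built from its
    last element; the condition is coded first and so ends up below the program. *)
Definition read_input : frag :=
  seqf (transfer t0 t3) (seqf (transfer t1 t2)
    (seqf (push t0 false) (seqf (drain t2 cons_bit)
      (seqf (push t0 false) (seqf (drain t3 cons_bit) (push t0 true)))))).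

Lemma run_read_input (p z : seq bool) :
  run read_input [:: p; z; [::]; [::]] (main (tcode (enc (p, z)))).
Proof.
have rr (s : seq bool) : s = catrev (rev s) [::] by rewrite -[RHS]/(rev (rev s)) revK.
apply: run_seq; first exact: run_transfer03.
apply: run_seq; first exact: run_transfer12.
apply: run_seq; first exact: run_push.
apply: (@run_seq _ _ _ [:: tcode (enc z); [::]; [::]; rev p]).
  rewrite /upd !cats0 -[set_nth _ _ _ _]/[:: [:: false]; [::]; rev z; rev p].
  rewrite [in X in run _ _ X](rr z).
  apply: (@run_drain t2 cons_bit (fun u v => [:: tcode (enc u); [::]; v; rev p])
    _ _ _ [::]) => // u b w.
  by have := @run_cons_bit b u [::] [:: [::]; w; rev p]; rewrite !cats0.
apply: run_seq; first exact: run_push.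
apply: (@run_seq _ _ _ [:: tcode (enc p) ++ tcode (enc z); [::]; [::]; [::]]).
  rewrite [in X in run _ _ X](rr p).
  by apply: (@run_drain t3 cons_bit
    (fun u v => [:: tcode (enc u) ++ tcode (enc z); [::]; [::]; v]) _ _ _ [::]) => // u b w;
    apply: run_cons_bit.
exact: run_push.
Qed.

Definition write_output : frag :=
  seqf (while is1 t0 (seqf (pop t0) (iff is1 t0
          (seqf (pop t0) (seqf (pop t0) (seqf (pop t0) (push t1 true))))
          (seqf (pop t0) (push t1 false)))))
    (seqf (pop t0) (transfer t1 t0)).

Lemma run_write_output (y : seq bool) :
  run write_output (main (tcode (enc y))) (main y).
Proof.
apply: (@run_seq _ _ _ [:: [:: false]; rev y; [::]; [::]]).
  (* The accumulator [a] on tape 1 holds the bits decoded so far, reversed. *)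
  apply: run_while; rewrite /main /rev; move: {1 5}[::] => a.
  elim: y a => [|b y IHy] a; first exact: whiles_stop.
  apply: whiles_next (IHy (b :: a)) => //.
  by case: b; run_auto.
apply: run_seq; first exact: run_pop.
by rewrite -[y in main y]revK -[rev (rev y)]cats0; apply: run_transfer10.
Qed.

Lemma read_bits_cat (y : seq bool) b : read_bits (map Some y ++ nseq b None) = y.
Proof. by elim: y => [|c y /= ->] //; case: b. Qed.

(** A relation takes the place of a function because the search below is partial: it requires a
    program that halts. *)
Lemma machine_of_frag (R : seq bool -> seq bool -> seq bool -> Prop) (F : frag) :
  (forall p z y m, R p z y ->
     run F (main (tcode (enc (p, z)) ++ m)) (main (tcode (enc y) ++ m))) ->
  exists V : machine, forall p z y, R p z y -> computes V p z y.
Proof.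
move=> hF; pose V := seqf read_input (seqf F write_output).
exists V => p z y /(hF _ _ _ [::]); rewrite !cats0 => r.
have rV : run V [:: p; z; [::]; [::]] (main y).
  apply: (@run_seq _ _ _ _ _ (@run_read_input p z)).
  exact: (@run_seq _ _ _ _ _ r (@run_write_output y)).
have [|q [tp st [hq ht]]] := rV (init V p z).2.
  by move=> [[|[|[|[|//]]]] lti]; rewrite /init ffunE /=; exists 0, 0; rewrite ?cats0.
have [t et] := steps_iter st; exists t, (q, tp); split=> //.
  suff hd : delta (q, tp).1 [ffun i => scan ((q, tp).2 i)] = None by rewrite /step hd.
  by rewrite (scan_holds ht); exact: hq.
rewrite /output /=; have [a [b ->]] := ht ord0.
exact: read_bits_cat.
Qed.

(** * The search algorithm *)

Section Bits.
Context {E : Type} {eE : Enc E}.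

Lemma comp_behead (A : Type) (eA : Enc A) (s : E -> seq A) :
  computable s -> computable (fun e => behead (s e)).
Proof. by move=> hs; rewrite /behead; comp. Qed.

Lemma comp_head (A : Type) (eA : Enc A) (a : A) (s : E -> seq A) :
  computable s -> computable (fun e => head a (s e)).
Proof. by move=> hs; rewrite /head; comp. Qed.

Lemma comp_andb (b c : E -> bool) :
  computable b -> computable c -> computable (fun e => b e && c e).
Proof. by move=> hb hc; rewrite /andb; comp. Qed.

Lemma comp_negb (b : E -> bool) : computable b -> computable (fun e => ~~ b e).
Proof. by move=> hb; rewrite /negb; comp. Qed.

Lemma comp_eqbool (b c : E -> bool) :
  computable b -> computable c -> computable (fun e => b e == c e).
Proof.
move=> hb hc.
apply: (@comp_eq _ _ _ _ (fun e => if b e then c e else if c e then false else true)).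
  by move=> e; case: (b e); case: (c e).
by comp.
Qed.

End Bits.

Ltac comp_bits := match goal with
  | |- computable (fun e => behead _) => apply: comp_behead
  | |- computable (fun e => head _ _) => apply: comp_head
  | |- computable (fun e => andb _ _) => apply: comp_andb
  | |- computable (fun e => negb _) => apply: comp_negb
  | |- computable (fun e => eq_op _ _) => apply: comp_eqbool
  end.
Ltac comp_hook ::= first [comp_lists | comp_bits].

(** Written as a fold, like the functions below, so that [comp_foldl] applies. *)
Definition eqbits (s t : seq bool) : bool :=
  let q := foldl (fun q b => if q.2 is c :: r then (q.1 && (b == c), r) else (false, [::]))
                 (true, t) s in
  q.1 && (if q.2 is [::] then true else false).

Lemma eqbitsE s t : eqbits s t = (s == t).
Proof.
pose f (q : bool * seq bool) b := if q.2 is c :: r then (q.1 && (b == c), r) else (false, [::]).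
suff gen ok : let q := foldl f (ok, t) s in
    q.1 && (if q.2 is [::] then true else false) = ok && (s == t) by exact: gen.
elim: s t ok => [|b s IHs] [|c t] ok //=; first by rewrite IHs andbF.
by rewrite IHs eqseq_cons andbA.
Qed.

Lemma comp_eqbits (E : Type) (eE : Enc E) (s t : E -> seq bool) :
  computable s -> computable t -> computable (fun e => s e == t e).
Proof.
move=> hs ht; apply: (@comp_eq _ _ _ _ (fun e => eqbits (s e) (t e))).
  by move=> e; apply: eqbitsE.
by rewrite /eqbits; comp.
Qed.

(** Undoes the padding [0^k 1 q]; the flag tells whether the first 1 has been met. *)
Definition strip (s : seq bool) : seq bool :=
  rev (foldl (fun q b => if q.1 then (true, b :: q.2) else (b, [::])) (false, [::]) s).2.

(* [(u, w)] if [p] and [rev u] have the same length. *)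
Definition split_prefix (p w : seq bool) : seq bool * seq bool :=
  foldl (fun q _ => if q.2 is b :: r then (b :: q.1, r) else q) ([::], w) p.

(** The first component of the accumulator is the carry. *)
Definition succ_bits (s : seq bool) : seq bool :=
  let q := foldl (fun q b => (q.1 && b, (if q.1 then ~~ b else b) :: q.2)) (true, [::]) s in
  rev (if q.1 then true :: q.2 else q.2).

(** Programs for protocols are run on the numeral of [n], which is recovered here from the length of
    [x]. *)
Definition bin_size (z : seq bool) : seq bool := foldl (fun s _ => succ_bits s) [::] z.

(** The order is that of [inputs], hence that of the tables in [encode]; the all-zero string comes
    first. *)
Definition all_bits (z : seq bool) : seq (seq bool) :=
  foldl (fun L _ => map (cons false) L ++ map (cons true) L) [:: [::]] z.

Definition read_bit (s : seq bool) : option bool * seq bool :=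
  if s is a :: s1 then
    if a then if s1 is b :: s2 then (Some b, s2) else (None, [::])
    else (None, s1)
  else (None, [::]).

(** Decodes [code_string], with the empty string for [None]. The list folded over only supplies
    enough rounds; the flag is raised at the end mark. *)
Definition read_string (s : seq bool) : seq bool * seq bool :=
  if s is a :: s1 then
    if a then
      let q := foldl (fun (q : bool * (seq bool * seq bool)) _ => if q.1 then q else
          if (read_bit q.2.2).1 is Some b then (false, (b :: q.2.1, (read_bit q.2.2).2))
          else (true, (q.2.1, (read_bit q.2.2).2))) (false, ([::], s1)) s1 in
      (rev q.2.1, q.2.2)
    else ([::], s1)
  else ([::], [::]).

(** Entries vary in length, so the whole table is decoded in order to find its end; only the entry
    at [z] is kept. *)
Definition read_table (X : Type) (rd : seq bool -> X * seq bool) (d : X)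
    (z : seq bool) (L : seq (seq bool)) (s : seq bool) : X * seq bool :=
  foldl (fun q w => (if w == z then (rd q.2).1 else q.1, (rd q.2).2)) (d, s) L.

(* A state consists of the value output by Alice if the walk is over, of the
   part of the code and the transcript of Bob that remain to be read, and of
   the number (in unary) of subtrees to be skipped. *)
Definition walk_state := (option (seq bool) * (seq bool * (seq bool * seq bool)))%type.

(** While skipping, an inner node turns one pending subtree into two and a leaf removes one.
    Otherwise bit 1 starts the skipping of the first subtree, and bit 0 enters it, leaving the
    second unread. Bits of Alice come from the table at [z], bits of Bob from the transcript. *)
Definition walk_step (z : seq bool) (L : seq (seq bool)) (st : walk_state) : walk_state :=
  if st.1 is Some _ then st else
  if st.2.1 is a :: s then
    if a then
      if s is who :: s' then
        let t := read_table read_bit None z L s' in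
        if st.2.2.2 is _ :: _ then (None, (t.2, (st.2.2.1, true :: st.2.2.2)))
        else if who then
          (None, (t.2, (behead st.2.2.1, if head false st.2.2.1 then [:: true] else [::])))
        else (None, (t.2, (st.2.2.1,
                if t.1 is Some b then if b then [:: true] else [::] else [::])))
      else st
    else
      let t := read_table read_string [::] z L s in
      if st.2.2.2 is _ :: k then (None, (t.2, (st.2.2.1, k))) else (Some t.1, st.2)
  else st.

(** A protocol has no more nodes than its code has bits, so [s] itself supplies enough rounds. *)
Definition walk (z s tau : seq bool) : seq bool :=
  if (foldl (fun st (_ : bool) => walk_step z (all_bits z) st)
            (None, (s, (tau, [::]))) s).1 is Some v then v else [::].

(** The last string of [L] outside [cs]; the inner fold is a membership test. *)
Definition missing (L cs : seq (seq bool)) : seq bool :=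
  foldl (fun y w => if foldl (fun b c => if c == w then true else b) false cs
                    then y else w) [::] L.

Section CompBits.
Context {E : Type} {eE : Enc E}.

Lemma comp_strip (s : E -> seq bool) : computable s -> computable (fun e => strip (s e)).
Proof. by move=> hs; rewrite /strip; comp. Qed.

Lemma comp_split_prefix (p w : E -> seq bool) :
  computable p -> computable w -> computable (fun e => split_prefix (p e) (w e)).
Proof. by move=> hp hw; rewrite /split_prefix; comp. Qed.

Lemma comp_succ_bits (s : E -> seq bool) :
  computable s -> computable (fun e => succ_bits (s e)).
Proof. by move=> hs; rewrite /succ_bits; comp. Qed.

Lemma comp_all_bits (s : E -> seq bool) :
  computable s -> computable (fun e => all_bits (s e)).
Proof. by move=> hs; rewrite /all_bits; comp. Qed.

Lemma comp_read_bit (s : E -> seq bool) :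
  computable s -> computable (fun e => read_bit (s e)).
Proof. by move=> hs; rewrite /read_bit; comp. Qed.

End CompBits.

Ltac comp_strings := match goal with
  | |- computable (fun e => eq_op _ _) => apply: comp_eqbits
  | |- computable (fun e => strip _) => apply: comp_strip
  | |- computable (fun e => split_prefix _ _) => apply: comp_split_prefix
  | |- computable (fun e => succ_bits _) => apply: comp_succ_bits
  | |- computable (fun e => all_bits _) => apply: comp_all_bits
  | |- computable (fun e => read_bit _) => apply: comp_read_bit
  end.
Ltac comp_hook ::= first [comp_lists | comp_bits | comp_strings].

Section CompWalk.
Context {E : Type} {eE : Enc E}.

Lemma comp_bin_size (s : E -> seq bool) :
  computable s -> computable (fun e => bin_size (s e)).
Proof. by move=> hs; rewrite /bin_size; comp. Qed.

Lemma comp_read_string (s : E -> seq bool) :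
  computable s -> computable (fun e => read_string (s e)).
Proof. by move=> hs; rewrite /read_string; comp. Qed.

Lemma comp_read_table (X : Type) (eX : Enc X) (rd : seq bool -> X * seq bool) (d : X)
    (z : E -> seq bool) (L : E -> seq (seq bool)) (s : E -> seq bool) :
  computable rd -> computable z -> computable L -> computable s ->
  computable (fun e => read_table rd d (z e) (L e) (s e)).
Proof. by move=> hrd hz hL hs; rewrite /read_table; comp. Qed.

Lemma comp_missing (L cs : E -> seq (seq bool)) :
  computable L -> computable cs -> computable (fun e => missing (L e) (cs e)).
Proof. by move=> hL hc; rewrite /missing; comp. Qed.

End CompWalk.

Ltac comp_tables := match goal with
  | |- computable (fun e => read_table _ _ _ _ _) => apply: comp_read_table
  | |- computable read_string => apply: (comp_read_string comp_id)
  | |- computable read_bit => apply: (comp_read_bit comp_id)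
  end.
Ltac comp_hook ::= first [comp_lists | comp_bits | comp_strings | comp_tables].

Lemma comp_walk (E : Type) (eE : Enc E) (z s tau : E -> seq bool) :
  computable z -> computable s -> computable tau ->
  computable (fun e => walk (z e) (s e) (tau e)).
Proof.
by move=> hz hs ht; rewrite /walk /walk_step; comp.
Qed.

(** * Simulation of a machine on coded configurations *)

#[local] Instance enc_symbol : Enc symbol := enc_option enc_bool.
#[local] Instance enc_tape : Enc tape := enc_prod (enc_seq enc_symbol) (enc_seq enc_symbol).

Definition code_move (d : move) : option bool :=
  match d with MoveL => None | Stay => Some false | MoveR => Some true end.
#[local] Instance enc_move : Enc move := fun d => enc (code_move d).

Section Tapes.
Context {E : Type} {eE : Enc E}.

Lemma comp_scan (t : E -> tape) : computable t -> computable (fun e => scan (t e)).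
Proof. by move=> ht; rewrite /scan; apply: comp_head; apply: comp_snd. Qed.

Lemma comp_code_move (d : E -> move) :
  computable d -> computable (fun e => code_move (d e)).
Proof.
by move=> hd; apply: (comp_comp _ hd); apply: (comp_enc (g := id) _ _ (comp_id (A := move))).
Qed.

Lemma comp_write_move (t : E -> tape) (a : E -> symbol * move) :
  computable t -> computable a -> computable (fun e => write_move (t e) (a e)).
Proof.
move=> ht ha.
have hb : computable (fun e => behead (t e).2) by comp.
have hl : computable (fun e => behead (t e).1) by comp.
have hh : computable (fun e => head None (t e).1) by comp.
have hd : computable (fun e => code_move (a e).2) by apply: comp_code_move; comp.
apply: (@comp_eq _ _ _ _ (fun e =>
  if code_move (a e).2 is Some r then
    if r then ((a e).1 :: (t e).1, behead (t e).2)
    else ((t e).1, (a e).1 :: behead (t e).2)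
  else (behead (t e).1, head None (t e).1 :: (a e).1 :: behead (t e).2))).
  by move=> e; rewrite /write_move; case: (a e).2.
by comp.
Qed.

Lemma comp_tape_of (s : E -> seq bool) : computable s -> computable (fun e => tape_of (s e)).
Proof. by move=> hs; rewrite /tape_of; comp. Qed.

Lemma comp_read_bits (r : E -> seq symbol) :
  computable r -> computable (fun e => read_bits (r e)).
Proof.
move=> hr.
apply: (@comp_eq _ _ _ _ (fun e => rev (foldl (fun (q : bool * seq bool) (a : symbol) =>
  if q.1 then q else if a is Some b then (false, b :: q.2) else (true, q.2))
  (false, [::]) (r e)).2)); last by comp.
move=> e; set f := (f in foldl f); rewrite -[RHS]revK; congr rev.
have stop b s : foldl f (true, b) s = (true, b) by elim: s.
rewrite /rev; elim: (r e) [::] => //= -[b|] s IHs l /=; first exact: IHs.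
by rewrite stop.
Qed.

End Tapes.

#[local] Instance enc_state (U : machine) : Enc (state U) :=
  fun q => iter (enum_rank q) (Node Leaf) Leaf.

#[local] Instance enc_config (U : machine) : Enc (config U) :=
  enc_prod (enc_state (U := U)) (enc_ffun enc_tape).

Lemma enc_state_inj (U : machine) : injective (enc : state U -> tree).
Proof.
move=> p q; rewrite /enc /enc_state => e; apply: enum_rank_inj; apply: val_inj => /=.
by elim: (nat_of_ord _) (nat_of_ord _) e => [|m IHm] [|n] //= [/IHm ->].
Qed.

Section Simulation.
Context (U : machine) {E : Type} {eE : Enc E}.

(** The transition function is a finite table, and the tapes are updated one by one. *)
Lemma comp_step_config (c : E -> config U) :
  computable c -> computable (fun e => step (c e)).
Proof.
apply: comp_comp.
apply: (@comp_eq _ _ _ _ (fun c : config U =>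
  if delta c.1 [ffun i => scan (c.2 i)] is Some a
  then Some (a.1, [ffun i => write_move (c.2 i) (a.2 i)]) else None)).
  by move=> d; rewrite /step; case: delta.
comp.
- apply: (@comp_comp _ _ _ _ _ _
    (fun q : state U * {ffun 'I_(extra_tapes U).+2 -> option bool} => delta q.1 q.2)
    (fun c : config U => (c.1, [ffun i => scan (c.2 i)]))).
    apply: comp_finite; apply: enc_prod_inj (@enc_state_inj U) _.
    by apply: enc_ffun_inj; apply: enc_option_inj; apply: enc_bool_inj.
  comp; apply: comp_ffun => i; apply: comp_scan; apply: comp_proj; comp.
- apply: comp_ffun => i; apply: comp_write_move; apply: comp_proj; comp.
Qed.

Lemma comp_init (p z : E -> seq bool) :
  computable p -> computable z -> computable (fun e => init U (p e) (z e)).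
Proof.
move=> hp hz; rewrite /init; comp; apply: comp_ffun => i.
by case: (val i) => [|[|n]]; apply: comp_tape_of; comp.
Qed.

Lemma comp_output (c : E -> config U) :
  computable c -> computable (fun e => output (c e)).
Proof.
by move=> hc; rewrite /output; apply: comp_read_bits; comp; apply: comp_proj; comp.
Qed.

End Simulation.

Lemma foldl_iter (A B : Type) (f : B -> B) (b : B) (s : seq A) :
  foldl (fun b _ => f b) b s = iter (size s) f b.
Proof. by elim: s b => //= a s IHs b; rewrite IHs -iterSr. Qed.

(** * The searching machine *)

Section Search.
Variable U : machine.

(** Halted configurations are fixed points, so simulating for too long does no harm. *)
Definition next_config (c : config U) : config U :=
  if step c is Some c' then c' else c.

(** [w] is a padded program, as long as [p], followed by a transcript; the length of [T] is the
    number of simulated steps. *)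
Definition candidate (T p z w : seq bool) : seq bool :=
  walk z (output (foldl (fun c (_ : bool) => next_config c)
                        (init U (strip (rev (split_prefix p w).1)) (bin_size z)) T))
    (split_prefix p w).2.

(** [behead] leaves out the all-zero index, so there are fewer candidates than strings. *)
Definition answer (T p z : seq bool) : seq bool :=
  missing (all_bits z) [seq candidate T p z w | w <- behead (all_bits z)].

Definition halts_at (p z : seq bool) (t : nat) : Prop :=
  step (iter t next_config (init U p z)) = None /\
  forall s, s < t -> step (iter s next_config (init U p z)) <> None.

(** The stripped program is run until it halts while its steps are counted in unary; the count is
    then the time allowed to every candidate. *)
Lemma searcher : exists V : machine, forall p z t,
  halts_at (strip p) (bin_size z) t -> computes V p z (answer (nseq t true) p z).
Proof.
pose A := ((seq bool * seq bool) * (seq bool * config U))%type.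
pose f (q : A) : bool * A :=
  if step q.2.2 is Some c then (true, (q.1, (true :: q.2.1, c))) else (false, q).
have hf : computable f by rewrite /f; comp; apply: comp_step_config; comp.
have [L hL] := comp_loop hf.
have [I hI] : computable (fun q : seq bool * seq bool =>
    (q, ([::] : seq bool, init U (strip q.1) (bin_size q.2)))).
  by comp; apply: comp_init; comp; apply: comp_bin_size; comp.
have [O hO] : computable (fun q : A => answer q.2.1 q.1.1 q.1.2).
  rewrite /answer /candidate; apply: comp_missing; comp.
  apply: comp_walk; comp; apply: comp_output; comp.
    by rewrite /next_config; comp; apply: comp_step_config; comp.
  by apply: comp_init; comp; apply: comp_bin_size; comp.
pose R p z y := exists2 t, halts_at (strip p) (bin_size z) t &
  y = answer (nseq t true) p z.
enough (hR : forall p z y m, R p z y ->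
    run (seqf I (seqf L O)) (main (tcode (enc (p, z)) ++ m)) (main (tcode (enc y) ++ m))).
  have [V hV] := machine_of_frag hR.
  by exists V => p z t h; apply: hV; exists t.
move=> p z y m [t [ht nt] ->].
apply: run_seq (hI (p, z) m) _.
pose c0 := init U (strip p) (bin_size z).
apply: run_seq (hO ((p, z), (nseq t true, iter t next_config c0)) m); apply: hL.
(* Induction on the number [d] of steps that remain before halting. *)
suff gen d : d <= t -> loops f ((p, z), (nseq (t - d) true, iter (t - d) next_config c0))
    ((p, z), (nseq t true, iter t next_config c0)).
  by have := gen t (leqnn t); rewrite subnn.
elim: d => [_|d IHd ltdt]; first by rewrite subn0; apply: loops_stop; rewrite /f ht.
have lt : t - d.+1 < t by rewrite ltn_subrL /=; case: (t) ltdt.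
move: (nt _ lt) (IHd (ltnW ltdt)); rewrite -(subnSK ltdt).
rewrite -/c0; case e: (step _) => [c|] // _ IH.
apply: loops_next; first by rewrite /f /= e.
by move: IH; rewrite iterS (_ : next_config _ = c) // /next_config e.
Qed.

End Search.

(** * What the folds compute *)

Lemma stripE k q : strip (nseq k false ++ true :: q) = q.
Proof.
rewrite /strip foldl_cat; set f := (f in foldl f).
have -> : foldl f (false, [::]) (nseq k false) = (false, [::]) by elim: k.
rewrite /= -[RHS]revK; congr rev; rewrite /rev.
suff gen l : foldl f (true, l) q = (true, catrev q l) by rewrite gen.
by elim: q l => //= b q IHq l; rewrite IHq.
Qed.

Lemma split_prefixE p u w : size u = size p -> split_prefix p (u ++ w) = (rev u, w).
Proof.
rewrite /split_prefix /rev; elim: p u [::] => [|b p IHp] [|c u] l //= [e].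
exact: IHp.
Qed.

Lemma succ_bitsE s : succ_bits s = bin_succ s.
Proof.
rewrite /succ_bits; set f := (f in foldl f) => /=.
have nocarry l r : foldl f (false, l) r = (false, catrev r l).
  by elim: r l => //= b r IHr l; rewrite IHr.
suff gen l : rev (if (foldl f (true, l) s).1 then true :: (foldl f (true, l) s).2
    else (foldl f (true, l) s).2) = rev l ++ bin_succ s.
  by rewrite gen.
elim: s l => [|[] s IHs] l /=; first by rewrite rev_cons cats1.
  by rewrite IHs rev_cons cat_rcons.
by rewrite nocarry /= catrevE rev_cat revK rev_cons cat_rcons.
Qed.

Lemma bin_sizeE z : bin_size z = bin_nat (size z).
Proof. by rewrite /bin_size foldl_iter; apply: eq_iter => s; apply: succ_bitsE. Qed.

Lemma all_bitsE n (x : n.-tuple bool) : all_bits x = [seq val w | w <- inputs n].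
Proof.
rewrite /all_bits foldl_iter size_tuple {x}.
by elim: n => //= n ->; rewrite cats0 map_cat -!map_comp.
Qed.

Lemma mem_all_bits z w : (w \in all_bits z) = (size w == size z).
Proof.
rewrite /all_bits foldl_iter; elim: (size z) w => [|n IHn] [|b w] //=.
- by rewrite mem_cat; apply/negP => /orP[] /mapP[].
- rewrite mem_cat; case: b; rewrite ?mem_map ?IHn; try by move=> ? ? [].
    by case: mapP => [[]|].
  by rewrite orbC; case: mapP => [[]|].
Qed.

Lemma size_all_bits z : size (all_bits z) = 2 ^ size z.
Proof.
rewrite /all_bits foldl_iter; elim: (size z) => //= n IHn.
by rewrite size_cat !size_map IHn expnS mul2n addnn.
Qed.

Lemma all_bits_uniq z : uniq (all_bits z).
Proof.
rewrite /all_bits foldl_iter; elim: (size z) => //= n IHn.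
rewrite cat_uniq !map_inj_uniq ?IHn ?andbT /=; try by move=> ? ? [].
by apply/hasPn => w /mapP[u _ ->]; apply/negP => /mapP[].
Qed.

Lemma all_bits_head z :
  all_bits z = nseq (size z) false :: behead (all_bits z).
Proof.
rewrite /all_bits foldl_iter; elim: (size z) => //= n ->.
by [].
Qed.

Lemma read_bitE a s : read_bit (code_bit a ++ s) = (a, s).
Proof. by case: a. Qed.

Lemma read_stringE a s : read_string (code_string a ++ s) = (odflt [::] a, s).
Proof.
case: a => [v|//]; rewrite /read_string /= -catA; set f := (f in foldl f).
have stop q r : foldl f (true, q) r = (true, q) by elim: r.
suff gen l r : size v < size r ->
    foldl f (false, (l, flatten [seq [:: true; b] | b <- v] ++ [:: false & s])) r =
    (true, (catrev v l, s)).
  rewrite gen /= ?revK // size_cat /= size_flatten /shape -map_comp.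
  by elim: v {gen} => //= b v IHv; rewrite !addSn ltnS ltnW.
elim: v l r => [|b v IHv] l [|c r] //=; first by rewrite stop.
exact: IHv.
Qed.

Lemma read_tableE (X Y : Type) (code : X -> seq bool) (rd : seq bool -> Y * seq bool)
    (h : X -> Y) (d : Y) n (x : n.-tuple bool) (f : n.-tuple bool -> X) s :
  (forall a u, rd (code a ++ u) = (h a, u)) ->
  read_table rd d x (all_bits x) (flatten [seq code (f w) | w <- inputs n] ++ s) =
  (h (f x), s).
Proof.
move=> hrd; rewrite all_bitsE /read_table.
set g := (g in foldl g).
suff gen d0 (L : seq (n.-tuple bool)) :
    foldl g (d0, flatten [seq code (f w) | w <- L] ++ s) [seq val w | w <- L] =
    (if x \in L then h (f x) else d0, s) by rewrite gen mem_inputs.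
elim: L d0 => //= w L IHL d0; rewrite -catA {2}/g hrd IHL inE.
by rewrite val_eqE eq_sym; case: eqP => [->|_] /=; rewrite ?if_same.
Qed.

Lemma missingP (L cs : seq (seq bool)) w :
  w \in L -> w \notin cs -> missing L cs \in L /\ missing L cs \notin cs.
Proof.
move=> wL wcs; rewrite /missing.
set g := (g in foldl g _ L).
have gE y v : g y v = if v \in cs then y else v.
  rewrite /g; congr (if _ then _ else _).
  rewrite -[RHS]orFb; elim: cs false {g wcs} => [|c r IHr] b /=; first by rewrite orbF.
  by rewrite IHr inE eq_sym; case: eqP; rewrite ?orbT ?orbF.
(* The accumulator keeps its initial value until a string outside [cs] is met, and is such a string
   from then on. *)
suff gen y : if has [predC cs] L then foldl g y L \in [predI L & [predC cs]]
             else foldl g y L == y.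
  have hL : has [predC cs] L by apply/hasP; exists w.
  by move: (gen [::]); rewrite hL inE => /andP[].
elim: L y {wL} => //= v L IHL y; have := IHL (g y v); rewrite inE /= gE.
case: hasP => [_|_ /eqP->]; first by rewrite orbT !inE => /andP[-> ->]; rewrite orbT.
by rewrite orbF inE; case: (boolP (v \in cs)) => //= vcs; rewrite !inE eqxx vcs.
Qed.

(** * Correctness *)

Fixpoint nodes n (P : protocol n) : nat :=
  match P with
  | AliceOutputs _ => 1
  | AliceSends _ P0 P1 | BobSends _ P0 P1 => (nodes P0 + nodes P1).+1
  end.

Lemma nodes_encode n (P : protocol n) : nodes P <= size (encode P).
Proof.
elim: P => [f|f P0 IH0 P1 IH1|f P0 IH0 P1 IH1] //=;
  by rewrite ltnS ltnW // ltnS !size_cat (leq_trans (leq_add IH0 IH1)) ?leq_addl.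
Qed.

(** * The walk through the code of a protocol follows its run *)

Section Walk.
Variables (n : nat) (x : n.-tuple bool).
Let next := walk_step x (all_bits x).

Lemma walk_skip (P : protocol n) u tau k :
  iter (nodes P) next (None, (encode P ++ u, (tau, true :: k))) =
  (None, (u, (tau, k))).
Proof.
elim: P u k => [f|f P0 IH0 P1 IH1|f P0 IH0 P1 IH1] u k.
- by rewrite /= /next /walk_step /= (read_tableE _ _ _ _ read_stringE).
- rewrite /= -iterS iterSr /next {2}/walk_step /= -/next.
  rewrite -catA (read_tableE _ _ _ _ read_bitE) /= addnC iterD -catA IH0.
  exact: IH1.
- rewrite /= -iterS iterSr /next {2}/walk_step /= -/next.
  rewrite -catA (read_tableE _ _ _ _ read_bitE) /= addnC iterD -catA IH0.
  exact: IH1.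
Qed.

(** [tau] consists of the bits that Bob sends. What follows it is arbitrary, to permit padding; what
    follows the code is arbitrary, because an unread second subtree may remain there. *)
Lemma walk_exec (P : protocol n) (y : n.-tuple bool) m v :
  exec P x y = Some (m, v) ->
  exists2 tau, size tau <= m & forall tau' u, exists j r, j <= nodes P /\
    iter j next (None, (encode P ++ u, (tau ++ tau', [::]))) = (Some v, r).
Proof.
elim: P m v => [f|f P0 IH0 P1 IH1|f P0 IH0 P1 IH1] m v /=.
- case e: (f x) => [w|] //= [<- <-]; exists [::] => // tau' u.
  exists 1, (encode (AliceOutputs f) ++ u, (tau', [::])); split=> //=.
  by rewrite /next /walk_step /= (read_tableE _ _ _ _ read_stringE) e.
- case e: (f x) => [b|] //=.
  case e': (if b then exec P1 x y else exec P0 x y) => [[m' v']|] //= [<- <-].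
  case: b e e' => e e'.
    have [tau sz h] := IH1 _ _ e'; exists tau; first exact: leqW.
    move=> tau' u; have [j [r [lej ej]]] := h tau' u.
    (* One round for the root and [nodes P0] rounds to skip the first subtree precede the walk
       through [P1]. *)
    exists (j + nodes P0).+1, r; split; first by rewrite ltnS addnC leq_add2l.
    rewrite iterSr /next {2}/walk_step /= -/next -catA.
    by rewrite (read_tableE _ _ _ _ read_bitE) e /= iterD -catA walk_skip.
  have [tau sz h] := IH0 _ _ e'; exists tau; first exact: leqW.
  move=> tau' u; have [j [r [lej ej]]] := h tau' (encode P1 ++ u).
  exists j.+1, r; split; first by rewrite ltnS (leq_trans lej) ?leq_addr.
  rewrite iterSr /next {2}/walk_step /= -/next -catA.
  by rewrite (read_tableE _ _ _ _ read_bitE) e /= -catA.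
- case e: (f y) => [b|] //=.
  case e': (if b then exec P1 x y else exec P0 x y) => [[m' v']|] //= [<- <-].
  case: b e e' => e e'.
    have [tau sz h] := IH1 _ _ e'; exists (true :: tau) => //.
    move=> tau' u; have [j [r [lej ej]]] := h tau' u.
    exists (j + nodes P0).+1, r; split; first by rewrite ltnS addnC leq_add2l.
    rewrite iterSr /next {2}/walk_step /= -/next -catA.
    by rewrite (read_tableE _ _ _ _ read_bitE) /= iterD -catA walk_skip.
  have [tau sz h] := IH0 _ _ e'; exists (false :: tau) => //.
  move=> tau' u; have [j [r [lej ej]]] := h tau' (encode P1 ++ u).
  exists j.+1, r; split; first by rewrite ltnS (leq_trans lej) ?leq_addr.
  rewrite iterSr /next {2}/walk_step /= -/next -catA.
  by rewrite (read_tableE _ _ _ _ read_bitE) /= -catA.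
Qed.

Lemma walkE (P : protocol n) (y : n.-tuple bool) m v l :
  exec P x y = Some (m, v) -> m <= l ->
  exists2 tau, size tau = l & walk x (encode P) tau = v.
Proof.
move=> /walk_exec[tau sz h] ml; have sl := leq_trans sz ml.
exists (tau ++ nseq (l - size tau) false); first by rewrite size_cat size_nseq subnKC.
have [j [r [lej]]] := h (nseq (l - size tau) false) [::].
rewrite cats0 /walk foldl_iter -/next => ej.
rewrite -(subnK (leq_trans lej (nodes_encode P))) iterD ej.
(* The surplus rounds change nothing once a value has been found. *)
by have -> : forall i, iter i next (Some v, r) = (Some v, r) by elim=> //= i ->.
Qed.

End Walk.

(** * Halting times *)

Section Halting.
Variable U : machine.

Lemma iter_next_halted (c : config U) t s : step (iter t (@next_config U) c) = None ->
  t <= s -> iter s (@next_config U) c = iter t (@next_config U) c.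
Proof.
move=> ht /subnK <-; rewrite iterD.
by elim: (s - t) => //= i ->; rewrite /next_config ht.
Qed.

Lemma computes_halts p z w : computes U p z w ->
  exists2 t, halts_at U p z t & output (iter t (@next_config U) (init U p z)) = w.
Proof.
case=> t [c [ec hc <-]].
have et : iter t (@next_config U) (init U p z) = c.
  elim: t c ec {hc} => [|t IHt] c /=; first by case.
  case e: (iter t _ _) => [d|] //= hd; rewrite (IHt _ e).
  by rewrite /next_config hd.
have ex : exists s, ~~ isSome (step (iter s (@next_config U) (init U p z))).
  by exists t; rewrite et hc.
case: (ex_minnP ex) => s hs min; have st : s <= t by apply: min; rewrite et hc.
have hs0 : step (iter s (@next_config U) (init U p z)) = None by case: step hs.
exists s; last by rewrite -et (iter_next_halted hs0 st).
split=> // i lti ei; have := min i; rewrite ei leqNgt lti => /(_ isT).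
by [].
Qed.

(** Induction on the list, with a classical decision whether the next program halts. *)
Lemma slowest z (rs : seq (seq bool)) :
  (forall r t, r \in rs -> ~ halts_at U r z t) \/
  exists r t, [/\ r \in rs, halts_at U r z t &
    forall r' t', r' \in rs -> halts_at U r' z t' -> t' <= t].
Proof.
have halts_uniq r t t' : halts_at U r z t -> halts_at U r z t' -> t <= t'.
  by move=> [_ h] [h' _]; rewrite leqNgt; apply/negP => /h.
elim: rs => [|a rs IH]; first by left.
case: (pselect (exists t, halts_at U a z t)) => [[s hs]|no]; last first.
  case: IH => [IH|[r [t [rin ht max]]]]; [left|right].
    by move=> r t; rewrite inE => /predU1P[-> h|/IH]; [case: no; exists t | apply].
  exists r, t; split=> //; first by rewrite inE rin orbT.
  by move=> r' t'; rewrite inE => /predU1P[-> h|/max]; [case: no; exists t' | apply].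
right; case: IH => [IH|[r [t [rin ht max]]]].
  exists a, s; split=> //; first exact: mem_head.
  by move=> r' t'; rewrite inE => /predU1P[-> /halts_uniq|/IH h /h //]; apply.
case: (leqP t s) => [ts|/ltnW st].
  exists a, s; split=> //; first exact: mem_head.
  move=> r' t'; rewrite inE => /predU1P[-> /halts_uniq|r'in h']; first exact.
  exact: leq_trans (max _ _ r'in h') ts.
exists r, t; split=> //; first by rewrite inE rin orbT.
move=> r' t'; rewrite inE => /predU1P[-> h'|]; last exact: max.
exact: leq_trans (halts_uniq _ _ _ h' hs) st.
Qed.

End Halting.

(** * Bounds on minima and on complexity *)

Lemma emin_le (A : option nat -> Prop) m :
  ele (emin A) (Some m) -> exists2 k, k <= m & A (Some k).
Proof.
rewrite /emin; case: pselect => // h; case: ex_minnP => k /asboolP Ak _ /= km.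
by exists k.
Qed.

Lemma le_emin (A : option nat -> Prop) m :
  (forall k, A (Some k) -> m <= k) -> ele (Some m) (emin A).
Proof.
rewrite /emin; case: pselect => // h; case: ex_minnP => k /asboolP Ak _ /=.
by apply.
Qed.

Lemma emin_ge (A : option nat -> Prop) k m : A (Some k) -> k <= m -> ele (emin A) (Some m).
Proof.
move=> Ak km; rewrite /emin; case: pselect => [h|[]]; last by exists k; apply/asboolP.
case: ex_minnP => i _ min /=; apply: leq_trans km; apply: min.
exact/asboolP.
Qed.

Lemma C_le (U : machine) w z p m : computes U p z w -> size p <= m -> ele (C U w z) (Some m).
Proof. by move=> h; apply: emin_ge; exists p. Qed.

(** * Padded programs and the counting argument *)

Definition pad (alpha : nat) (q : seq bool) : seq bool :=
  nseq (alpha - size q) false ++ true :: q.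

Lemma size_pad alpha q : size q <= alpha -> size (pad alpha q) = alpha.+1.
Proof. by move=> le; rewrite size_cat size_nseq /= addnS subnK. Qed.

Lemma strip_pad alpha q : strip (pad alpha q) = q.
Proof. exact: stripE. Qed.

Definition bits n : seq (seq bool) := all_bits (nseq n false).

Lemma mem_bits n w : (w \in bits n) = (size w == n).
Proof. by rewrite mem_all_bits size_nseq. Qed.

Section Answer.
Variables (U : machine) (alpha n t : nat) (x : n.-tuple bool) (p : seq bool).
Hypothesis sp : size p = alpha.+1.

Lemma candidate_pad r tau : size r <= alpha ->
  candidate U (nseq t true) p x (pad alpha r ++ tau) =
  walk x (output (iter t (@next_config U) (init U r (bin_nat n)))) tau.
Proof.
move=> sr; rewrite /candidate split_prefixE ?sp ?size_pad //= revK strip_pad.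
by rewrite bin_sizeE size_tuple foldl_iter size_nseq.
Qed.

(** Pigeonhole, for any [t] and any [p] of the right length: [2^n - 1] candidates miss some [n]-bit
    string, and every padded program with a transcript of the remaining length indexes a
    candidate. *)
Lemma answerP : let y := answer U (nseq t true) p x in
  size y = n /\ forall r tau, size r <= alpha -> alpha < n -> size tau = n - alpha.+1 ->
    walk x (output (iter t (@next_config U) (init U r (bin_nat n)))) tau <> y.
Proof.
move=> y.
pose cs := [seq candidate U (nseq t true) p x w | w <- behead (all_bits x)].
have [w win wout] : exists2 w, w \in all_bits x & w \notin cs.
  apply/hasP; apply: contraT => /hasPn sub.
  have /(uniq_leq_size (all_bits_uniq x)) : {subset all_bits x <= cs}.
    by move=> w /sub; rewrite negbK.
  by rewrite size_map size_behead size_all_bits leqNgt ltn_predL expn_gt0.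
have [yin yout] := missingP win wout.
split; first by move: yin; rewrite mem_all_bits size_tuple => /eqP.
move=> r tau sr lt st ey; case/negP: yout; rewrite -/(answer _ _ _ _) -/y -ey.
rewrite -(candidate_pad tau sr); apply: map_f.
have : pad alpha r ++ tau \in all_bits x.
  by rewrite mem_all_bits size_cat size_pad // st size_tuple subnKC.
(* The index is not the omitted all-zero string, since its padding contains a 1. *)
rewrite all_bits_head inE => /predU1P[e|//].
have : true \in pad alpha r ++ tau by rewrite !mem_cat inE eqxx orbT.
by rewrite e mem_nseq andbF.
Qed.

End Answer.

(** * The two bounds, by copying [x] if no short program halts and by searching otherwise *)

Lemma copier : exists V : machine, forall z, computes V [::] z z.
Proof.
have [F hF] : computable (fun q : seq bool * seq bool => q.2) by comp.
have [V hV] := @machine_of_frag (fun _ z y => z = y) F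
  (fun p z y m (e : z = y) => eq_ind _ (fun y => run F _ (main (tcode (enc y) ++ m)))
     (hF (p, z) m) _ e).
by exists V => z; apply: hV.
Qed.

Theorem theorem6 (U : machine) (hU : universal U) :
  exists c : nat, forall (alpha n : nat) (x : n.-tuple bool),
    exists y : n.-tuple bool,
      ele (Some (n - alpha)) (CC U (@I n) alpha x y) /\
      ele (C U y x) (Some (alpha + c)).
Proof.
have [V hV] := searcher U; have [c hc] := hU V.
have [W hW] := copier; have [d hd] := hU W.
(* [c] is the overhead of the searcher, whose program has one bit more than [alpha]; [d] is that of
   the copier. *)
exists (c.+1 + d) => alpha n x.
pose rs := [seq r <- flatten [seq bits i | i <- iota 0 alpha.+1] | size r <= alpha].
have mem_rs r : (r \in rs) = (size r <= alpha).
  rewrite mem_filter andb_idr // => le; apply/flattenP; exists (bits (size r)).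
    by apply: map_f; rewrite mem_iota.
  by rewrite mem_bits.
have protocolP (P : protocol n) : ele (protocol_C U P) (Some alpha) ->
    exists r s, [/\ size r <= alpha, halts_at U r (bin_nat n) s &
      output (iter s (@next_config U) (init U r (bin_nat n))) = encode P].
  move=> /emin_le[k le [r /computes_halts[s hs os] [ek]]].
  by exists r, s; split; rewrite // -ek.
case: (slowest U (bin_nat n) rs) => [none|[q [t [qrs ht max]]]].
  (* No protocol has complexity at most [alpha], so the minimum is over the empty set. *)
  exists x; split.
    apply: le_emin => k [P [_ /protocolP[r [s [sr hs _]]] _]].
    by case: (none r s); rewrite ?mem_rs.
  have [q sq hq] := hd _ _ _ (hW x).
  by apply: C_le hq _; rewrite (leq_trans sq) // add0n addnA leq_addl.
rewrite mem_rs in qrs; pose p := pad alpha q.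
have sp : size p = alpha.+1 by exact: size_pad.
have [sy ny] := answerP U t x sp; set y := answer _ _ _ _ in sy ny.
have sy' : size y == n by rewrite sy.
exists (Tuple sy'); split.
  apply: le_emin => m [P [_ /protocolP[r [s [sr hs os]]]]].
  rewrite /CCP; case e: exec => [[k v]|] //; case: eqP => // ev [->].
  (* With fewer than [n - alpha] bits exchanged, the bits of Bob fit into the [n - alpha.+1] places
     that the padded program leaves in an [n]-bit index. *)
  rewrite leqNgt; apply/negP => lt.
  have lt' : alpha < n by rewrite -subn_gt0 (leq_ltn_trans _ lt).
  have [|tau st wt] := walkE (l := n - alpha.+1) e; first by rewrite subnS -ltnS prednK ?subn_gt0.
  apply: (ny r tau sr lt' st).
  (* As [q] halts last, [r] has halted within [t] steps, and its output is the code of [P]. *)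
  rewrite (iter_next_halted hs.1); last by apply: (max r) => //; rewrite mem_rs.
  by rewrite os wt ev.
have hp : halts_at U (strip p) (bin_size x) t.
  by rewrite strip_pad bin_sizeE size_tuple.
have [q' sq' hq'] := hc _ _ _ (hV _ _ _ hp).
apply: C_le hq' _; rewrite (leq_trans sq') // sp addSnnS leq_add2l.
by rewrite leq_addr.
Qed.
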